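(* Let $n\ge 1$, let $X_{\lambda_1},\ldots,X_{\lambda_n}$ be independent random variables with $X_{\lambda_i}\sim W(\alpha,\lambda_i)$, where $\lambda_i>0$ for $i=1,\ldots,n$, and let $X_{\theta_1},\ldots,X_{\theta_n}$ be another set of independent random variables with $X_{\theta_i}\sim W(\alpha,\theta_i)$, where $\theta_i>0$ for $i=1,\ldots,n$. Let $X_{n:n}^{\lambda}=\max(X_{\lambda_1},\ldots,X_{\lambda_n})$ and $X_{n:n}^{\theta}=\max(X_{\theta_1},\ldots,X_{\theta_n})$. Then, for $0<\alpha\le 1$, $$(\lambda_1,\ldots,\lambda_n)\preceq^{w}(\theta_1,\ldots,\theta_n)\ \Rightarrow\ X_{n:n}^{\lambda}\le_{rh}X_{n:n}^{\theta}.$$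
   Context: Weibull distribution: $X\sim W(\alpha,\lambda)$ (shape $\alpha>0$, parameter $\lambda>0$) means $X$ has density $f(t)=\alpha\lambda(\lambda t)^{\alpha-1}e^{-(\lambda t)^{\alpha}}$ for $t>0$, i.e. distribution function $1-e^{-(\lambda t)^{\alpha}}$ for $t>0$. ''Increasing'' means non-decreasing. Weak majorization: for $x,y\in\mathbb{R}^n$ with increasing arrangements $x_{(1)}\le\cdots\le x_{(n)}$ and $y_{(1)}\le\cdots\le y_{(n)}$, $x\preceq^{w}y$ means $\sum_{i=1}^{j}x_{(i)}\ge\sum_{i=1}^{j}y_{(i)}$ for all $j=1,\ldots,n$. Reverse hazard rate order: for random variables $X,Y$ with distribution functions $F,G$, $X\le_{rh}Y$ means that $G(t)/F(t)$ is increasing in $t$ over all $t$ for which the ratio is well defined. *)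

(* Defs.v *)
From HB Require Import structures.
From mathcomp Require Import all_boot all_order all_algebra.
From mathcomp Require Import all_classical all_reals all_analysis.
From mathcomp Require Import measurable_realfun.

Set Implicit Arguments.
Unset Strict Implicit.
Unset Printing Implicit Defensive.

Import Order.TTheory GRing.Theory Num.Theory.
Import numFieldNormedType.Exports.

Local Open Scope classical_set_scope.
Local Open Scope ring_scope.

Definition increasing_arrangement (R : realType) (n : nat) (x : 'I_n -> R) :
  seq R := sort <=%R (codom x).

(* [x] is weakly majorized by [y]: the partial sums run over the [j] smallest
   entries, and those of [x] dominate. *)
Definition weak_majorized (R : realType) (n : nat) (x y : 'I_n -> R) : Prop :=
  forall j : nat, (1 <= j <= n)%N ->
    \sum_(i < j) (increasing_arrangement x)`_i >=
    \sum_(i < j) (increasing_arrangement y)`_i.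

(* The type [{RV P >-> R}] unfolds to [{mfun T >-> R}], which does not mention
   [P]: the probability is therefore an explicit argument of what follows. *)
Definition has_density d (T : measurableType d) (R : realType)
    (P : probability T R) (X : {RV P >-> R}) (f : R -> R) : Prop :=
  forall A : set R, measurable A ->
    distribution P X A = (\int[lebesgue_measure]_(t in A) (f t)%:E)%E.

Arguments has_density {d T R} P X f.

Definition weibull_pdf (R : realType) (alpha lambda t : R) : R :=
  if 0 < t then
    alpha * lambda * (lambda * t) `^ (alpha - 1) *
      expR (- ((lambda * t) `^ alpha))
  else 0.

Definition weibull d (T : measurableType d) (R : realType)
    (P : probability T R) (X : {RV P >-> R}) (alpha lambda : R) : Prop :=
  has_density P X (weibull_pdf alpha lambda).

Arguments weibull {d T R} P X alpha lambda.

Definition mutually_independent d (T : measurableType d) (R : realType)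
    (P : probability T R) (I : finType) (X : I -> {RV P >-> R}) : Prop :=
  forall (J : {set I}) (A : I -> set R), (forall i, measurable (A i)) ->
    P (\bigcap_(i in [set` J]) (X i @^-1` A i)) =
    (\prod_(i in J) P (X i @^-1` A i))%E.

Arguments mutually_independent {d T R} P {I} X.

(* The family has [n.+1] members, so [X ord0] is a harmless base value. *)
Definition max_rv d (T : measurableType d) (R : realType)
    (n : nat) (X : 'I_n.+1 -> {mfun T >-> R}) : T -> R :=
  fun w => \big[Num.max/X ord0 w]_(i < n.+1) X i w.

Lemma measurable_max_rv d (T : measurableType d) (R : realType)
    (n : nat) (X : 'I_n.+1 -> {mfun T >-> R}) :
  measurable_fun [set: T] (max_rv X).
Proof.
rewrite /max_rv; elim: (index_enum _) => [|i s IHs].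
  by under eq_fun do rewrite big_nil; exact: measurable_funPT.
under eq_fun do rewrite big_cons.
by apply: measurable_maxr => //; exact: measurable_funPT.
Qed.

HB.instance Definition _ d (T : measurableType d) (R : realType)
    (n : nat) (X : 'I_n.+1 -> {mfun T >-> R}) :=
  isMeasurableFun.Build _ _ _ _ (max_rv X) (measurable_max_rv X).

(* Reversed hazard rate order: the ratio [cdf Y / cdf X] is non-decreasing,
   taken where its denominator, the distribution function of [X], is nonzero;
   [fine] is harmless as distribution functions are finite. *)
Definition rh_le d (T : measurableType d) d' (T' : measurableType d')
    (R : realType) (P : probability T R) (Q : probability T' R)
    (X : {RV P >-> R}) (Y : {RV Q >-> R}) : Prop :=
  forall s t : R, cdf X s != 0%E -> cdf X t != 0%E -> s <= t ->
    fine (cdf Y s) / fine (cdf X s) <= fine (cdf Y t) / fine (cdf X t).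

Arguments rh_le {d T d' T' R} P Q X Y.

(* Main.v *)
(* The maximum has distribution function prod_i (1 - exp(- l_i^a x)) in the time
   scale x = t^a.  The logarithmic derivative in x of the ratio of the two
   products is (1/x) times the sum over i of
   g(theta_i^a x) - g(lambda_i^a x), where g(v) = v / (exp v - 1).
   Since g is convex and decreasing and u |-> u^a is concave and increasing for
   a <= 1, the function u |-> g(u^a x) is convex and decreasing; a subgradient
   of it is nonpositive and nondecreasing, so that Abel summation along the
   increasing arrangements turns weak majorization into nonnegativity of the
   derivative. *)
Require Import Defs.
From HB Require Import structures.
From mathcomp Require Import all_boot all_order all_algebra.
From mathcomp Require Import all_classical all_reals all_analysis.
From mathcomp Require Import measurable_realfun ring lra.

Set Implicit Arguments.
Unset Strict Implicit.
Unset Printing Implicit Defensive.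

Import Order.TTheory GRing.Theory Num.Theory.
Import numFieldNormedType.Exports.

Local Open Scope classical_set_scope.
Local Open Scope ring_scope.

(** * Monotonicity and tangent lines from derivatives *)

Lemma derive_ge0_le (R : realType) (f df : R -> R) (a b : R) : a <= b ->
  (forall x, a <= x <= b -> is_derive x 1 f (df x)) ->
  (forall x, a <= x <= b -> 0 <= df x) -> f a <= f b.
Proof.
move=> ab fdf df0.
have [|c|c cab fE] := @MVT_segment R f df a b ab.
- by move=> x /[!in_itv]/= /andP[ax xb]; apply: fdf; rewrite !ltW.
- apply: derivable_within_continuous => x /[!in_itv]/= xab.
  by case: (fdf _ xab).
- rewrite -subr_ge0 fE mulr_ge0 ?subr_ge0// df0//.
Qed.

(** The map [z |-> f z - df x * z] has derivative [df z - df x], nonpositive to the left of [x] and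
    nonnegative to its right, so it is minimal at [x]. *)
Lemma tangent_le (R : realType) (f df : R -> R) :
  (forall x : R, 0 < x -> is_derive x 1 f (df x)) ->
  (forall x y : R, 0 < x -> x <= y -> df x <= df y) ->
  forall x y : R, 0 < x -> 0 < y -> f x + df x * (y - x) <= f y.
Proof.
move=> fdf df_homo x y x0 y0.
have deriv (z : R) : 0 < z ->
    is_derive z 1 (fun z => f z - df x * z) (df z - df x).
  move=> z0; have ? := fdf _ z0.
  by apply: is_derive_eq; rewrite /GRing.scale/=; ring.
have [xy|/ltW yx] := leP x y.
  suff : f x - df x * x <= f y - df x * y by lra.
  apply: (@derive_ge0_le R (fun z => f z - df x * z)
    (fun z => df z - df x)) => // z /andP[xz _].
    by apply: deriv; lra.
  by rewrite subr_ge0 df_homo.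
suff : - (f y - df x * y) <= - (f x - df x * x) by lra.
apply: (@derive_ge0_le R (fun z => - (f z - df x * z))
  (fun z => - (df z - df x))) => // z /andP[yz zx].
  by have ? : is_derive z 1 _ _ := deriv z (lt_le_trans y0 yz); exact: is_deriveN.
by rewrite oppr_ge0 subr_le0 df_homo// (lt_le_trans y0).
Qed.

(** * Convexity and decrease of [v / (expR v - 1)], alone and composed with a power *)

Lemma expR_sub1_mul_le1 (R : realType) (v : R) : (1 - v) * expR v <= 1.
Proof.
have := expR_ge1Dx (- v); rewrite expRN -(ler_pM2r (expR_gt0 v)).
by rewrite mulVf ?gt_eqF ?expR_gt0.
Qed.

(** The expression vanishes at 0, and its derivative [(v - 1) * expR v + 1] is nonnegative by the
    preceding inequality. It carries the sign of the second derivative of [bose]. *)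
Lemma expR_pade_ge0 (R : realType) (v : R) : 0 <= v ->
  0 <= (v - 2) * expR v + v + 2.
Proof.
move=> v0.
have : (0 - 2) * expR 0 + 0 + 2 <= (v - 2) * expR v + v + 2.
  apply: (@derive_ge0_le R (fun v => (v - 2) * expR v + v + 2)
    (fun v => (v - 1) * expR v + 1)) => // x _.
    apply: is_derive_eq; rewrite /GRing.scale/=; ring.
  have := expR_sub1_mul_le1 x; lra.
by rewrite expR0; lra.
Qed.

(** The generating function of the Bernoulli numbers. Division by zero gives it the value 0 at 0
    instead of its limit 1, so it is used at positive arguments only. *)
Definition bose (R : realType) (v : R) : R := v / (expR v - 1).

Definition dbose (R : realType) (v : R) : R :=
  (expR v - 1 - v * expR v) / (expR v - 1) ^+ 2.

Lemma expR_sub1_gt0 (R : realType) (v : R) : 0 < v -> 0 < expR v - 1.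
Proof. by move=> v0; rewrite subr_gt0 expR_gt1. Qed.

Lemma is_derive_bose (R : realType) (v : R) : 0 < v ->
  is_derive v 1 (@bose R) (dbose v).
Proof.
move=> v0; have e0 := expR_sub1_gt0 v0.
have ? : is_derive v 1 (fun v => (expR v - 1)^-1)
    (- (expR v - 1) ^- 2 * expR v).
  apply: is_derive_eq; first by apply: is_deriveV; rewrite gt_eqF.
  by rewrite /GRing.scale/=; ring.
apply: is_derive_eq; rewrite /dbose /GRing.scale/=.
by field; rewrite gt_eqF.
Qed.

Lemma dbose_le0 (R : realType) (v : R) : dbose v <= 0.
Proof.
rewrite /dbose mulr_le0_ge0 ?invr_ge0 ?sqr_ge0//.
by have := expR_sub1_mul_le1 v; lra.
Qed.

Lemma dbose_nondecreasing (R : realType) (u v : R) : 0 < u -> u <= v ->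
  dbose u <= dbose v.
Proof.
move=> u0 uv.
(* The function supplied is the second derivative of [bose]. *)
apply: (@derive_ge0_le R (@dbose R) (fun v => expR v *
  ((v - 2) * expR v + v + 2) / (expR v - 1) ^+ 3) u v uv) => x /andP[ux _].
  have x0 := lt_le_trans u0 ux; have e0 := expR_sub1_gt0 x0.
  have ? : is_derive x 1 (fun v => ((expR v - 1) ^+ 2)^-1)
      (- ((expR x - 1) ^+ 2) ^- 2 * (2 * (expR x - 1) * expR x)).
    apply: is_derive_eq; first by apply: is_deriveV; rewrite gt_eqF ?exprn_gt0.
    by rewrite /GRing.scale/=; ring.
  apply: is_derive_eq; rewrite /GRing.scale/=.
  by field; rewrite gt_eqF.
have x0 := lt_le_trans u0 ux; have e0 := expR_sub1_gt0 x0.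
rewrite divr_ge0 ?exprn_ge0 ?(ltW e0)//.
by rewrite mulr_ge0 ?expR_ge0 ?expR_pade_ge0 ?ltW.
Qed.

Lemma bose_tangent (R : realType) (u v : R) : 0 < u -> 0 < v ->
  bose u + dbose u * (v - u) <= bose v.
Proof.
move=> u0 v0; apply: tangent_le => //; [exact: is_derive_bose|].
exact: dbose_nondecreasing.
Qed.

(* Weights [a] and [1 - a] on the tangent inequality [ln u <= u - 1], taken at
   [u = z / m] and [u = 1 / m] with [m] the right-hand side. *)
Lemma powR_tangent1 (R : realType) (a z : R) : 0 < a <= 1 -> 0 < z ->
  z `^ a <= 1 + a * (z - 1).
Proof.
move=> /andP[a0 a1] z0; set m := 1 + a * (z - 1).
have m0 : 0 < m.
  by rewrite (_ : m = a * z + (1 - a)) ?ltr_pwDl ?mulr_gt0 ?subr_ge0// /m; ring.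
have lnz : ln z - ln m <= z / m - 1.
  rewrite -ln_div ?posrE//.
  by have := expR_ge1Dx (ln (z / m)); rewrite lnK ?posrE ?divr_gt0//; lra.
have lnm : - ln m <= m^-1 - 1.
  rewrite -lnV ?posrE//.
  by have := expR_ge1Dx (ln m^-1); rewrite lnK ?posrE ?invr_gt0//; lra.
rewrite -[leRHS]lnK ?posrE// /powR gt_eqF// ler_expR -subr_ge0.
have a1' : 0 <= 1 - a by rewrite subr_ge0.
have := lerD (ler_wpM2l (ltW a0) lnz) (ler_wpM2l a1' lnm).
have -> : a * (z / m - 1) + (1 - a) * (m^-1 - 1) = 0.
  by rewrite /m; field; rewrite gt_eqF.
lra.
Qed.

(** By homogeneity: the tangent at 1, taken at [y / x] and multiplied by [x] to the power [a]. *)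
Lemma powR_tangent (R : realType) (a x y : R) : 0 < a <= 1 ->
  0 < x -> 0 < y -> y `^ a <= x `^ a + a * x `^ a / x * (y - x).
Proof.
move=> a01 x0 y0.
have := powR_tangent1 a01 (divr_gt0 y0 x0).
rewrite -(ler_pM2r (powR_gt0 a x0)) -powRM ?divr_ge0 ?(ltW x0) ?(ltW y0)//.
rewrite divfK ?gt_eqF// => /le_trans; apply.
by rewrite le_eqVlt; apply/orP; left; apply/eqP; field; rewrite gt_eqF.
Qed.

(** The slope is the chain-rule derivative. The tangent bounds the power from above, and multiplying
    by [dbose], which is nonpositive, turns this into the lower bound wanted. *)
Lemma bose_powR_tangent (R : realType) (a tau x y : R) : 0 < a <= 1 ->
  0 < tau -> 0 < x -> 0 < y ->
  bose (x `^ a * tau) +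
    dbose (x `^ a * tau) * (a * x `^ a / x * tau) * (y - x) <=
  bose (y `^ a * tau).
Proof.
move=> a01 tau0 x0 y0.
have xa0 := powR_gt0 a x0; have ya0 := powR_gt0 a y0.
apply: le_trans (bose_tangent (mulr_gt0 xa0 tau0) (mulr_gt0 ya0 tau0)).
rewrite lerD2l -mulrA ler_wnM2l ?dbose_le0// mulrAC -mulrBl ler_pM2r//.
by have := powR_tangent a01 x0 y0; lra.
Qed.

(** * Abel summation and weak majorization *)

(** Adding the subgradient inequalities at [x] and at [y] cancels the values of [f]; the composite
    function need not be differentiated twice. *)
Lemma subgradient_nondecreasing (R : realType) (f c : R -> R) :
  (forall x y : R, 0 < x -> 0 < y -> f x + c x * (y - x) <= f y) ->
  forall x y : R, 0 < x -> x <= y -> c x <= c y.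
Proof.
move=> fc x y x0; rewrite le_eqVlt => /predU1P[->//|xy].
have y0 := lt_trans x0 xy.
have := lerD (fc _ _ x0 y0) (fc _ _ y0 x0) => h.
have : (c x - c y) * (y - x) <= 0 by lra.
by rewrite pmulr_lle0 ?subr_gt0// subr_le0.
Qed.

Lemma weighted_sum_ge0 (R : realType) (c e : nat -> R) (n : nat) :
  (forall i, (i <= n)%N -> c i <= 0) ->
  (forall i, (i < n)%N -> c i <= c i.+1) ->
  (forall j, (j <= n)%N -> \sum_(i < j.+1) e i <= 0) ->
  0 <= \sum_(i < n.+1) c i * e i.
Proof.
move=> c0 c_homo e0.
(* Abel summation as an induction: replacing [c m] by the larger [c m.+1] in front of a nonpositive
   partial sum only lowers the product. At [m = n] both factors on the left are nonpositive. *)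
suff H m : (m <= n)%N ->
    c m * (\sum_(i < m.+1) e i) <= \sum_(i < m.+1) c i * e i.
  by apply: le_trans (H n _) => //; rewrite mulr_le0 ?c0 ?e0.
elim: m => [|m IHm] mn; first by rewrite !big_ord1.
rewrite (big_ord_recr m.+1) [leRHS](big_ord_recr m.+1)/= mulrDr lerD2r.
apply: le_trans (IHm (ltnW mn)).
by rewrite ler_wnM2r ?e0 ?c_homo// ltnW.
Qed.

Lemma size_increasing_arrangement (R : realType) (n : nat) (x : 'I_n -> R) :
  size (increasing_arrangement x) = n.
Proof. by rewrite size_sort size_codom card_ord. Qed.

Lemma increasing_arrangement_gt0 (R : realType) (n : nat) (x : 'I_n -> R) i :
  (forall k, 0 < x k) -> (i < n)%N -> 0 < (increasing_arrangement x)`_i.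
Proof.
move=> x0 ilt.
have : (increasing_arrangement x)`_i \in codom x.
  by rewrite -(mem_sort <=%R) mem_nth// size_increasing_arrangement.
by move=> /codomP[k ->].
Qed.

Lemma sum_increasing_arrangement (R : realType) (n : nat) (x : 'I_n -> R)
  (f : R -> R) :
  \sum_i f (x i) = \sum_(i < n) f (increasing_arrangement x)`_i.
Proof.
transitivity (\sum_(y <- increasing_arrangement x) f y).
  rewrite (perm_big (codom x)) /=; last by rewrite perm_sort.
  by rewrite /codom /image_mem big_map big_enum.
by rewrite (big_nth 0) size_increasing_arrangement big_mkord.
Qed.

(** Entries are paired by rank, and each difference of values of [f] is bounded below by the
    subgradient at the entry of [x]. These slopes are nonpositive and increase with the rank, as
    Abel summation requires. *)
Lemma weak_majorized_sum_le (R : realType) (n : nat) (x y : 'I_n.+1 -> R)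
  (f c : R -> R) : (forall i, 0 < x i) -> (forall i, 0 < y i) ->
  (forall u v : R, 0 < u -> 0 < v -> f u + c u * (v - u) <= f v) ->
  (forall u : R, 0 < u -> c u <= 0) ->
  weak_majorized x y -> \sum_i f (x i) <= \sum_i f (y i).
Proof.
move=> x0 y0 fc c0 xy.
set xs := increasing_arrangement x; set ys := increasing_arrangement y.
rewrite (sum_increasing_arrangement x f) (sum_increasing_arrangement y f).
rewrite -subr_ge0 -sumrB.
apply: le_trans (_ : 0 <= \sum_(i < n.+1) c xs`_i * (ys`_i - xs`_i)) _.
  apply: (@weighted_sum_ge0 R (fun i => c xs`_i) (fun i => ys`_i - xs`_i)).
  - by move=> i lein; rewrite c0 ?increasing_arrangement_gt0.
  - move=> i ltin; apply: subgradient_nondecreasing fc _ _ _ _.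
      by rewrite increasing_arrangement_gt0// ltnW.
    have /(sorted_leq_nth le_trans (@lexx _ R) 0) : sorted <=%R xs.
      exact: sort_le_sorted.
    apply; rewrite ?inE ?size_increasing_arrangement//.
    by rewrite ltnW.
  (* The index [j] starts at 0 and stands for the [j.+1] smallest entries. *)
  - move=> j lejn; rewrite sumrB subr_le0; exact: xy.
apply: ler_sum => i _.
have := fc xs`_i ys`_i (increasing_arrangement_gt0 x0 (ltn_ord i))
  (increasing_arrangement_gt0 y0 (ltn_ord i)); lra.
Qed.

(** * Ratios of products of exponential distribution functions *)

Lemma sub1_expRN_gt0 (R : realType) (v : R) : 0 < v -> 0 < 1 - expR (- v).
Proof. by move=> v0; rewrite subr_gt0 expR_lt1 oppr_lt0. Qed.

(** The logarithmic derivative is [m * expR (- (m * x)) / (1 - expR (- (m * x)))], that is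
    [m / (expR (m * x) - 1)]. *)
Lemma is_derive_ln_exp_cdf (R : realType) (m x : R) : 0 < m -> 0 < x ->
  is_derive x 1 (fun z => ln (1 - expR (- (m * z)))) (bose (m * x) / x).
Proof.
move=> m0 x0.
have e0 : 0 < 1 - expR (- (m * x)) by rewrite sub1_expRN_gt0 ?mulr_gt0.
have de : is_derive x 1 (fun z => 1 - expR (- (m * z)))
    (m * expR (- (m * x))).
  have ? : is_derive x 1 (fun z => expR (- (m * z))) (expR (- (m * x)) * - m).
    apply: (@is_derive1_comp R expR (fun z => - (m * z))).
    by apply: is_derive_eq; rewrite /GRing.scale/=; ring.
  by apply: is_derive_eq; rewrite /GRing.scale/=; ring.
apply: is_derive_eq.
  exact: (@is_derive1_comp R (@ln R) (fun z => 1 - expR (- (m * z))) _ _ _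
    (is_derive1_ln e0) de).
rewrite /bose expRN; have := expR_sub1_gt0 (mulr_gt0 m0 x0).
have := expR_gt0 (m * x).
set E := expR _ => E0 E1.
field.
by rewrite !gt_eqF//.
Qed.

Lemma prod_exp_cdf_ratio_le (R : realType) (n : nat) (mu nu : 'I_n -> R)
  (s t : R) : (forall i, 0 < mu i) -> (forall i, 0 < nu i) ->
  (forall x : R, 0 < x ->
    \sum_i bose (nu i * x) <= \sum_i bose (mu i * x)) ->
  0 < s -> s <= t ->
  (\prod_i (1 - expR (- (mu i * s)))) / (\prod_i (1 - expR (- (nu i * s)))) <=
  (\prod_i (1 - expR (- (mu i * t)))) / (\prod_i (1 - expR (- (nu i * t)))).
Proof.
move=> mu0 nu0 bose_le s0 st.
pose D i (x : R) : R :=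
  ln (1 - expR (- (mu i * x))) - ln (1 - expR (- (nu i * x))).
(* Taking logarithms turns the ratio into a sum that can be differentiated term by term. *)
have ratioE x : 0 < x -> (\prod_i (1 - expR (- (mu i * x)))) /
    (\prod_i (1 - expR (- (nu i * x)))) = expR ((\sum_i D i) x).
  move=> x0; rewrite -prodf_div fct_sumE expR_sum; apply: eq_bigr => i _.
  by rewrite /D -ln_div ?lnK ?posrE ?divr_gt0 ?sub1_expRN_gt0 ?mulr_gt0.
rewrite !ratioE ?(lt_le_trans s0 st)// ler_expR.
apply: (@derive_ge0_le R (\sum_i D i)
  (fun x => \sum_i (bose (mu i * x) / x - bose (nu i * x) / x)) s t st) => x.
  move=> /andP[sx _]; have x0 := lt_le_trans s0 sx.
  apply: is_derive_sum => i.
  have ? := is_derive_ln_exp_cdf (mu0 i) x0.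
  have ? := is_derive_ln_exp_cdf (nu0 i) x0.
  exact: is_deriveB.
move=> /andP[sx _]; have x0 := lt_le_trans s0 sx.
by rewrite sumrB -!mulr_suml -mulrBl divr_ge0 ?(ltW x0)// subr_ge0 bose_le.
Qed.

(** * Distribution function of the Weibull law *)

Definition weibull_ccdf (R : realType) (a l t : R) : R :=
  expR (- (l * t) `^ a).

Lemma is_derive_scaled_powR (R : realType) (a l x : R) : 0 < l -> 0 < x ->
  is_derive x 1 (fun z => (l * z) `^ a) (a * (l * x) `^ (a - 1) * l).
Proof.
move=> l0 x0.
apply: (@is_derive1_comp R (fun z => z `^ a) (fun z => l * z)).
  by apply: is_derive1_powR; rewrite mulr_gt0.
by apply: is_derive_eq; rewrite /GRing.scale/=; ring.
Qed.

Lemma is_derive_weibull_ccdf (R : realType) (a l x : R) : 0 < l -> 0 < x ->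
  is_derive x 1 (weibull_ccdf a l) (- weibull_pdf a l x).
Proof.
move=> l0 x0; have dp := is_derive_scaled_powR a l0 x0.
have dN : is_derive x 1 (fun z => - (l * z) `^ a)
    (- (a * (l * x) `^ (a - 1) * l)) by exact: is_deriveN.
rewrite (_ : weibull_ccdf a l = expR \o (fun z => - (l * z) `^ a))//.
have ? := is_derive1_comp (is_derive_expR _) dN; apply: is_derive_eq.
by rewrite /weibull_pdf x0; ring.
Qed.

Lemma weibull_pdf_continuous (R : realType) (a l x : R) : 0 < l -> 0 < x ->
  {for x, continuous (weibull_pdf a l)}.
Proof.
move=> l0 x0; apply/differentiable_continuous/derivable1_diffP.
(* Near a positive point the case distinction in the density disappears. *)
apply: (@near_eq_derivable R R R
    (fun z => a * l * (l * z) `^ (a - 1) * expR (- (l * z) `^ a))).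
  by near=> z; rewrite /weibull_pdf ifT//; near: z; exact: lt_nbhsr.
have ? := is_derive_scaled_powR (a - 1) l0 x0.
have ? : is_derive x 1 (fun z => expR (- (l * z) `^ a)) (- weibull_pdf a l x).
  exact: is_derive_weibull_ccdf.
exact: ex_derive.
Unshelve. all: by end_near. Qed.

Lemma weibull_pdf_ge0 (R : realType) (a l x : R) : 0 < a -> 0 < l ->
  0 <= weibull_pdf a l x.
Proof.
move=> a0 l0; rewrite /weibull_pdf; case: ifP => // _.
by rewrite !mulr_ge0 ?powR_ge0 ?expR_ge0 ?ltW.
Qed.

Lemma weibull_ccdf_cvgy (R : realType) (a l : R) : 0 < a -> 0 < l ->
  weibull_ccdf a l x @[x --> +oo] --> 0.
Proof.
move=> a0 l0.
apply: (@cvg_comp _ _ _ (fun x => (l * x) `^ a) (fun y => expR (- y)) _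
  (pinfty_nbhs R)); last exact: cvgr_expR.
apply/cvgryPge => A; near=> x.
(* The bound [A] may be negative; [M] is positive, so it is the [a]-th power of its own [a]-th
   root. *)
pose M := Num.max 1 A.
have M0 : 0 < M by rewrite lt_max ltr01.
have : M `^ a^-1 / l <= x.
  by near: x; apply: nbhs_pinfty_ge; exact: num_real.
rewrite ler_pdivrMr// mulrC => x_ge.
apply: (@le_trans _ _ M); first by rewrite le_max lexx orbT.
have -> : M = (M `^ a^-1) `^ a by rewrite -powRrM mulVf ?gt_eqF// powRr1// ltW.
rewrite ge0_ler_powR ?nnegrE ?powR_ge0 ?(ltW a0)//.
exact: le_trans (powR_ge0 _ _) x_ge.
Unshelve. all: by end_near. Qed.

(** The fundamental theorem of calculus with antiderivative [- weibull_ccdf a l], which tends to 0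
    at infinity. Integrating over the tail avoids the origin, where the density is unbounded when
    [a < 1]. *)
Lemma integral_weibull_pdf (R : realType) (a l t : R) :
  0 < a -> 0 < l -> 0 < t ->
  (\int[lebesgue_measure]_(x in `]t, +oo[) (weibull_pdf a l x)%:E =
   (weibull_ccdf a l t)%:E)%E.
Proof.
move=> a0 l0 t0.
have cpdf : {within `[t, +oo[, continuous (weibull_pdf a l)}.
  apply/continuous_within_itvcyP; split.
    move=> x; rewrite in_itv/= andbT => tx.
    exact: weibull_pdf_continuous (lt_trans t0 tx).
  by apply: cvg_at_right_filter; exact: weibull_pdf_continuous.
have deriv x : t <= x ->
    is_derive x 1 (fun z => - weibull_ccdf a l z) (weibull_pdf a l x).
  move=> tx; have ? := is_derive_weibull_ccdf a l0 (lt_le_trans t0 tx).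
  by apply: is_derive_eq; rewrite opprK.
rewrite integral_itv_obnd_cbnd; last first.
  apply/measurable_EFinP; apply: open_continuous_measurable_fun => //.
  by move: cpdf => /continuous_within_itvcyP[/in_continuous_mksetP].
rewrite (@ge0_continuous_FTC2y _ _ (fun z => - weibull_ccdf a l z) t 0) //.
- by rewrite sub0e -EFinN opprK.
- by move=> x _; exact: weibull_pdf_ge0.
- by rewrite -oppr0; apply: cvgN; exact: weibull_ccdf_cvgy.
- by move=> x tx; case: (deriv x (ltW tx)).
- apply: cvg_at_right_filter.
  have /derivable1_diffP/differentiable_continuous :
    derivable (fun z => - weibull_ccdf a l z) t 1 by case: (deriv t (lexx t)).
  exact.
- move=> x; rewrite in_itv/= andbT => tx; rewrite derive1E.
  by case: (deriv x (ltW tx)).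
Qed.

Lemma weibull_cdf d (T : measurableType d) (R : realType)
  (P : probability T R) (X : {RV P >-> R}) (a l t : R) :
  0 < a -> 0 < l -> weibull P X a l ->
  cdf X t = (if 0 < t then 1 - weibull_ccdf a l t else 0)%:E.
Proof.
move=> a0 l0 Xal; case: ltP => t0; last first.
  rewrite /cdf Xal//; apply: integral0_eq => x /=; rewrite in_itv/= => xt.
  by rewrite /weibull_pdf ltNge (le_trans xt t0).
(* Passing to the complement reduces the claim to the tail integral. *)
rewrite /cdf -[X in distribution _ _ X]setCK setCitvl.
rewrite probability_setC// EFinB; congr (_ - _)%E.
by rewrite -integral_weibull_pdf//; exact: Xal.
Qed.

(** * Distribution function of the maximum, and conclusion *)

Lemma cdf_max_rv d (T : measurableType d) (R : realType)
  (P : probability T R) (n : nat) (X : 'I_n.+1 -> {RV P >-> R}) (t : R) :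
  mutually_independent P X ->
  cdf (max_rv X : {RV P >-> R}) t = (\prod_i cdf (X i) t)%E.
Proof.
move=> X_indep.
have H := X_indep [set: 'I_n.+1]%SET (fun=> `]-oo, t]%classic).
transitivity
  (P (\bigcap_(i in [set` [set: 'I_n.+1]%SET]) (X i @^-1` `]-oo, t]))).
  rewrite /cdf /distribution /pushforward; congr (P _).
  apply/seteqP; split=> w /=; rewrite in_itv/=.
    by move=> /bigmax_leP[_ +] i _ => /(_ i isT); rewrite /= in_itv.
  move=> Xt; have {}Xt i : X i w <= t.
    by have := Xt i; rewrite /= in_itv/= inE; apply.
  (* The base value of the maximum is [X ord0 w], bounded like every other member. *)
  by apply/bigmax_leP; split.
by rewrite H//; apply: eq_bigl => i; rewrite finset.in_setT.
Qed.

Theorem theorem4p1 (R : realType) (n : nat)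
  (d : measure_display) (T : measurableType d) (P : probability T R)
  (d' : measure_display) (T' : measurableType d') (Q : probability T' R)
  (alpha : R) (lambda theta : 'I_n.+1 -> R)
  (X : 'I_n.+1 -> {RV P >-> R}) (Y : 'I_n.+1 -> {RV Q >-> R})
  (alpha_gt0 : 0 < alpha) (alpha_le1 : alpha <= 1)
  (lambda_gt0 : forall i, 0 < lambda i)
  (theta_gt0 : forall i, 0 < theta i)
  (X_indep : mutually_independent P X)
  (Y_indep : mutually_independent Q Y)
  (X_weibull : forall i, weibull P (X i) alpha (lambda i))
  (Y_weibull : forall i, weibull Q (Y i) alpha (theta i)) :
  weak_majorized lambda theta -> rh_le P Q (max_rv X) (max_rv Y).
Proof.
move=> lambda_theta s t Xs _ st.
(* For [s <= 0] the first factor of the product vanishes, against the nonzero denominator. *)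
have s0 : 0 < s.
  rewrite ltNge; apply/negP => s_le0; move: Xs; rewrite cdf_max_rv//.
  rewrite big_ord_recl (weibull_cdf _ alpha_gt0 (lambda_gt0 _) (X_weibull _)).
  by rewrite ltNge s_le0/= mul0e eqxx.
have t0 := lt_le_trans s0 st.
have fine_cdf d0 (T0 : measurableType d0) (P0 : probability T0 R)
    (Z : 'I_n.+1 -> {RV P0 >-> R}) (l : 'I_n.+1 -> R) x :
    mutually_independent P0 Z -> (forall i, 0 < l i) ->
    (forall i, weibull P0 (Z i) alpha (l i)) -> 0 < x ->
    fine (cdf (max_rv Z : {RV P0 >-> R}) x) =
    \prod_i (1 - expR (- (l i `^ alpha * x `^ alpha))).
  move=> Zind l0 Zl x0; rewrite cdf_max_rv//.
  rewrite (eq_bigr (fun i => (1 - expR (- (l i `^ alpha * x `^ alpha)))%:E)).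
    by rewrite prodEFin.
  move=> i _; rewrite (weibull_cdf _ alpha_gt0 (l0 i) (Zl i)) x0 /weibull_ccdf.
  by rewrite powRM ?(ltW (l0 i)) ?(ltW x0).
rewrite (fine_cdf _ _ _ X lambda s)// (fine_cdf _ _ _ X lambda t)//.
rewrite (fine_cdf _ _ _ Y theta s)// (fine_cdf _ _ _ Y theta t)//.
(* The rates are the powers of [theta] above and of [lambda] below, in the time scale given by the
   power [alpha]. *)
apply: prod_exp_cdf_ratio_le.
- by move=> i; exact: powR_gt0.
- by move=> i; exact: powR_gt0.
- move=> x x0; have alpha01 : 0 < alpha <= 1 by rewrite alpha_gt0.
  apply: (weak_majorized_sum_le (f := fun u => bose (u `^ alpha * x))
    (c := fun u => dbose (u `^ alpha * x) * (alpha * u `^ alpha / u * x))) => //.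
    by move=> u v; exact: bose_powR_tangent.
  move=> u u0; rewrite mulr_le0_ge0 ?dbose_le0//.
  by rewrite !mulr_ge0 ?invr_ge0 ?powR_ge0 ?(ltW x0) ?(ltW u0) ?(ltW alpha_gt0).
- exact: powR_gt0.
- by rewrite ge0_ler_powR ?nnegrE ?(ltW alpha_gt0) ?(ltW s0) ?(ltW t0).
Qed.
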